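(* Let $\ell\ge2$, $r\ge2$, $m\in\mathbb{Z}_{\ge0}$, $k\in\mathbb{Z}$ with $k\geq -m-1$, and integers $\overline{m}_1,\dots,\overline{m}_\ell$ with $0\le\overline{m}_i\le r-1$ such that $m_i:=r(m+k)+1+\overline{m}_i\ge0$ for all $i$. Let $(\mathcal{A},\mu)$ be the multiarrangement in $\mathbb{C}^\ell$ with defining polynomial \[ Q(\mathcal{A},\mu)=\prod_{i=1}^\ell x_i^{m_i}\cdot\prod_{1\le i<j\le\ell}(x_i^r-x_j^r)^{2m+1}, \] i.e. the hyperplane $x_i=0$ has multiplicity $m_i$ and each hyperplane $x_i-\zeta x_j=0$ ($i<j$, $\zeta^r=1$) has multiplicity $2m+1$. Let $\lambda(t)=\prod_{i=1}^\ell(t^r-x_i^r)$ and $\eta^m_u=\sum_{i=1}^\ell\left(\int^{x_i}t^{ru}\lambda(t)^m\,dt\right)\partial_i$ for $u\in\mathbb{Z}$. Then the vector fields \[ \left(\prod_{i=1}^\ell x_i^{\overline{m}_i}\right)\eta^m_k,\quad \eta^m_{k+1},\quad\eta^m_{k+2},\quad\dots,\quad\eta^m_{k+\ell-1} \] form a basis of the $S$-module $D(\mathcal{A},\mu)$.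
   Context: $S=\mathbb{C}[x_1,\dots,x_\ell]$, $\partial_i=\partial/\partial x_i$, $\operatorname{Der}_S=\bigoplus_iS\partial_i$. For a multiarrangement $(\mathcal{A},\mu)$ (linear hyperplanes $H=\ker\alpha_H$ with multiplicities $\mu(H)\in\mathbb{Z}_{\ge0}$), $D(\mathcal{A},\mu)=\{\delta\in\operatorname{Der}_S\mid\delta\alpha_H\in(\alpha_H^{\mu(H)})\ \forall H\}$. The operator $\int^{x_i}\,dt$ is the linear operator on Laurent polynomials in $t$ with coefficients in $\mathbb{C}[x_1,\dots,x_\ell]$ given by $\int^{x_i}t^j\,dt=\frac{x_i^{j+1}}{j+1}$ for $j\neq-1$ (all exponents of $t$ occurring are multiples of $r$, so $j=-1$ never occurs); for $j\ge0$ it equals $\int_0^{x_i}$. *)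

(* Defs.v *)
From HB Require Import structures.
From mathcomp Require Import all_boot all_order all_algebra fraction.
From mathcomp Require Import separable cyclotomic.
From mathcomp.multinomials Require Import mpoly.
From mathcomp.real_closed Require Import complex.
From mathcomp Require reals.

Set Implicit Arguments.
Unset Strict Implicit.
Unset Printing Implicit Defensive.

Import reals.Real.Exports.
Import Order.TTheory GRing.Theory Num.Theory.
Local Open Scope ring_scope.

Section Multiarrangements.
Variables (K : fieldType) (l : nat).
Local Notation S := {mpoly K[l]}.

Definition linform (a : 'rV[K]_l) : S := \sum_(i < l) a 0 i *: 'X_i.

Lemma linform_delta i : linform (delta_mx 0 i) = 'X_i.
Proof.
rewrite /linform (bigD1 i) //= mxE !eqxx scale1r big1 ?addr0 // => j ji.
by rewrite mxE (negbTE ji) scale0r.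
Qed.

Lemma linformBZ a b c : linform (a - c *: b) = linform a - c *: linform b.
Proof.
rewrite /linform scaler_sumr -sumrB; apply: eq_bigr => i _.
by rewrite !mxE scalerBl scalerA.
Qed.

(* Hyperplanes are the kernels of the linear forms with coefficient vectors
   [hcoef H]; distinct indices give distinct hyperplanes. *)
Record multiarrangement := Multiarrangement {
  hidx : finType;
  hcoef : hidx -> 'rV[K]_l;
  hmult : hidx -> nat;
  hcoef_neq0 : forall H, hcoef H != 0;
  hcoef_ncol : forall H H' (c : K), H != H' -> hcoef H != c *: hcoef H'
}.

Definition hform (A : multiarrangement) (H : hidx A) : S :=
  linform (hcoef H).

Definition defining_poly (A : multiarrangement) : S :=
  \prod_(H : hidx A) hform H ^+ hmult H.

(* The row vector [d] stands for the derivation [\sum_i d 0 i * d/dx_i]; in this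
   way ['rV[S]_l] is the free S-module Der_S. *)
Definition der_apply (d : 'rV[S]_l) (f : S) : S :=
  \sum_(i < l) d 0 i * f^`M(i).

Definition logder (A : multiarrangement) (d : 'rV[S]_l) : Prop :=
  forall H : hidx A, exists g : S,
    der_apply d (hform H) = g * hform H ^+ hmult H.

End Multiarrangements.

Definition is_module_basis (R : pzRingType) (V : lmodType R) (D : V -> Prop)
    (n : nat) (b : 'I_n -> V) : Prop :=
  [/\ forall j, D (b j),
      forall v, D v -> exists c : 'I_n -> R, v = \sum_(j < n) c j *: b j
    & forall c : 'I_n -> R,
        \sum_(j < n) c j *: b j = 0 -> forall j, c j = 0].

Section UnityRoots.
Variable K : numClosedFieldType.

Definition unity_roots (r : nat) : seq K :=
  undup (sval (closed_field_poly_normal ('X^r - 1 : {poly K}))).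

Lemma mem_unity_roots r z : (0 < r)%N -> (z \in unity_roots r) = (z ^+ r == 1).
Proof.
move=> r0; rewrite mem_undup.
case: closed_field_poly_normal => /= s.
rewrite (monicP (monicXnsubC 1 r0)) scale1r => e.
by rewrite -root_prod_XsubC -e rootE !hornerE subr_eq0.
Qed.

Lemma prod_unity_roots (l r : nat) (a b : {mpoly K[l]}) : (0 < r)%N -> b != 0 ->
  \prod_(z <- unity_roots r) (a - z *: b) = a ^+ r - b ^+ r.
Proof.
move=> r0 b0; rewrite /unity_roots.
case: closed_field_poly_normal => /= s.
rewrite (monicP (monicXnsubC 1 r0)) scale1r => e.
have us : uniq s.
  by rewrite -separable_prod_XsubC -e separable_Xn_sub_1 // pnatr_eq0 -lt0n.
have sz : size s = r.
  by have := size_XnsubC (1 : K) r0; rewrite e size_prod_XsubC => -[].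
rewrite undup_id //; apply/eqP; rewrite -tofrac_eq; apply/eqP.
pose f := @FracField.tofrac _ \o @mpolyC l K.
have fF0 : FracField.tofrac b != 0 by rewrite tofrac_eq0.
have := congr1 (fun p => (map_poly f p).[FracField.tofrac a / FracField.tofrac b]) e.
rewrite /f rmorphB /= map_polyXn rmorph1 !hornerE.
move/(congr1 (fun x => FracField.tofrac b ^+ r * x)).
rewrite mulrBr mulr1 -exprMn mulrC divfK // -!rmorphXn -rmorphB => ->.
rewrite -{}sz {e us}; elim: s => [|z s IHs].
  by rewrite !big_nil !rmorph1 hornerC mulr1.
rewrite !big_cons /= !rmorphM hornerM exprS rmorphM /= mulrACA -IHs; congr (_ * _).
rewrite !rmorphB /= map_polyX map_polyC /= !hornerE mulrBr mulrCA divff // mulr1.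
by rewrite -mul_mpolyC rmorphM /= [_ * FracField.tofrac b]mulrC.
Qed.

End UnityRoots.

Section MonomialArrangement.
Variables (K : numClosedFieldType) (l r : nat) (r_gt1 : (1 < r)%N).
Variables (mu0 : 'I_l -> nat) (mu1 : nat).

Definition mono_hidx : finType :=
  ('I_l + {ij : 'I_l * 'I_l | (ij.1 < ij.2)%N} * seq_sub (unity_roots K r))%type.

Definition mono_hcoef (H : mono_hidx) : 'rV[K]_l :=
  match H with
  | inl i => delta_mx 0 i
  | inr (ij, z) =>
      delta_mx 0 (sval ij).1 - ssval z *: delta_mx 0 (sval ij).2
  end.

Definition mono_hmult (H : mono_hidx) : nat :=
  match H with inl i => mu0 i | inr _ => mu1 end.

Lemma ssval_unity_neq0 (z : seq_sub (unity_roots K r)) : ssval z != 0.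
Proof.
have := ssvalP z; rewrite mem_unity_roots ?(ltnW r_gt1) //.
by apply: contraTneq => ->; rewrite expr0n gtn_eqF ?(ltnW r_gt1) // eq_sym oner_eq0.
Qed.

Lemma ltn_ord_neq (i j : 'I_l) : (i < j)%N -> i != j.
Proof. by move=> ij; rewrite -val_eqE neq_ltn ij. Qed.

Lemma mono_hcoef_neq0 H : mono_hcoef H != 0.
Proof.
case: H => [i|[[[i j] /= ij] z]] /=; apply/eqP => /rowP /(_ i).
  by rewrite !mxE !eqxx => /eqP; rewrite oner_eq0.
rewrite !mxE !eqxx (_ : i == j = false) ?mulr0 ?subr0 => [/eqP|].
  by rewrite oner_eq0.
by apply/negbTE; rewrite -val_eqE neq_ltn ij.
Qed.

Lemma mono_hcoef_ncol H H' (c : K) :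
  H != H' -> mono_hcoef H != c *: mono_hcoef H'.
Proof.
move=> neqH; apply/eqP => e.
have E k : mono_hcoef H 0 k = c * mono_hcoef H' 0 k by rewrite e mxE.
move: neqH E {e}.
case: H => [i|[[[i j] /= ij] z]]; case: H' => [i'|[[[i' j'] /= ij'] z']] neqH E.
- have := E i; rewrite /= !mxE !eqxx /=.
  have -> : i == i' = false by apply: contraNF neqH => /eqP ->.
  by rewrite mulr0 => /eqP; rewrite oner_eq0.
- have [nij z0] := (ltn_ord_neq ij', ssval_unity_neq0 z').
  have := E i; have := E i'; have := E j'; rewrite /= !mxE !eqxx /=.
  rewrite (negbTE nij) [j' == i']eq_sym (negbTE nij).
  rewrite mulr0 subr0 mulr1 sub0r mulr1 => e2 e1 /eqP.
  case: eqP e1 e2 => [<-|_] /= <-; last by rewrite !mul0r oner_eq0.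
  rewrite [j' == i']eq_sym (negbTE nij) mul1r => /eqP.
  by rewrite eq_sym oppr_eq0 (negbTE z0).
- have [nij z0] := (ltn_ord_neq ij, ssval_unity_neq0 z).
  have := E i; have := E j; rewrite /= !mxE !eqxx /=.
  rewrite (negbTE nij) (eq_sym j i) (negbTE nij) mulr0 subr0 sub0r mulr1.
  case: eqP => [<-|_] /eqP.
    by rewrite (negbTE nij) mulr0 => _ /eqP; rewrite oner_eq0.
  by rewrite mulr0 oppr_eq0 (negbTE z0).
- have [nij z0] := (ltn_ord_neq ij, ssval_unity_neq0 z).
  have nij' := ltn_ord_neq ij'.
  have := E i; have := E j; rewrite /= !mxE !eqxx /=.
  rewrite (negbTE nij) (eq_sym j i) (negbTE nij) mulr0 subr0 sub0r mulr1.
  have [ei|ni] := eqVneq i i'; last first.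
    have [ej|nj] := eqVneq i j'; last first.
      by rewrite mulr0 subr0 mulr0 => _ /eqP; rewrite oner_eq0.
    have -> : j == i' = false.
      apply/negbTE; rewrite eq_sym; apply: ltn_ord_neq.
      by apply: (ltn_trans _ ij); rewrite ej.
    have -> : j == j' = false by rewrite -ej eq_sym (negbTE nij).
    by rewrite mulr0 subr0 mulr0 => /eqP; rewrite oppr_eq0 (negbTE z0).
  have -> : i == j' = false by rewrite ei (negbTE nij').
  have -> : j == i' = false by rewrite -ei eq_sym (negbTE nij).
  rewrite mulr0 subr0 mulr1 sub0r => /[swap] <-; rewrite mul1r.
  have [ej|nj] := eqVneq j j'; last first.
    by rewrite mulr0 oppr0 => /eqP; rewrite oppr_eq0 (negbTE z0).
  rewrite mulr1 => /oppr_inj ez; case/negP: neqH; apply/eqP.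
  by congr (inr (_, _)); apply: val_inj => //=; rewrite ei ej.
Qed.

(* x_i = 0 with multiplicity [mu0 i], and x_i - z x_j = 0 with multiplicity
   [mu1] for i < j and z ^ r = 1. *)
Definition monomial_multiarrangement : multiarrangement K l :=
  @Multiarrangement K l mono_hidx mono_hcoef mono_hmult
    mono_hcoef_neq0 mono_hcoef_ncol.

Lemma defining_poly_monomial :
  defining_poly monomial_multiarrangement =
    (\prod_(i < l) 'X_i ^+ mu0 i) *
    \prod_(i < l) \prod_(j < l | (i < j)%N) ('X_i ^+ r - 'X_j ^+ r) ^+ mu1.
Proof.
have r_gt0 := ltnW r_gt1.
rewrite /defining_poly big_sumType /=; congr (_ * _).
  by apply: eq_bigr => i _; rewrite /hform /= linform_delta.
rewrite (eq_bigr (fun Hz : {ij : 'I_l * 'I_l | (ij.1 < ij.2)%N} *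
    seq_sub (unity_roots K r) => ('X_(sval Hz.1).1
       - ssval Hz.2 *: 'X_(sval Hz.1).2) ^+ mu1)); last first.
  case=> ij z _; rewrite /hform /=.
  by rewrite linformBZ !linform_delta.
rewrite -(pair_bigA _ (fun (ij : {ij : 'I_l * 'I_l | (ij.1 < ij.2)%N})
   (z : seq_sub (unity_roots K r)) => ('X_(sval ij).1
       - ssval z *: 'X_(sval ij).2) ^+ mu1)) /=.
rewrite (eq_bigr (fun ij : {ij : 'I_l * 'I_l | (ij.1 < ij.2)%N} =>
   ('X_(sval ij).1 ^+ r - 'X_(sval ij).2 ^+ r) ^+ mu1)); last first.
  case=> [[i j] /= ij] _; rewrite prodrXl; congr (_ ^+ _).
  rewrite -prod_unity_roots // -?msupp_eq0 ?msuppX //.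
  rewrite -(big_map (@ssval _ _) xpredT (fun z => 'X_i - z *: 'X_j)).
  apply/perm_big/uniq_perm; rewrite ?undup_uniq //.
    by rewrite map_inj_uniq ?index_enum_uniq //; apply: val_inj.
  move=> z; apply/mapP/idP => [[x _ ->]|zs]; first exact: ssvalP.
  by exists (SeqSub zs); rewrite ?mem_index_enum.
rewrite [RHS]pair_big_dep /=.
by rewrite [RHS](big_sub [pred ij : 'I_l * 'I_l | (ij.1 < ij.2)%N]
  (fun ij => ('X_ij.1 ^+ r - 'X_ij.2 ^+ r) ^+ mu1)).
Qed.

End MonomialArrangement.

Section Eta.
Variables (K : fieldType) (l : nat).
Local Notation S := {mpoly K[l]}.
Local Notation F := {fraction S}.

(* The value at the Laurent polynomial [t ^ a * p(t)] of the integration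
   operator [t ^ j |-> x_i ^ (j + 1) / (j + 1)]. The result may have a pole
   along x_i = 0, so it lives in the fraction field of S. The term j = -1 is
   sent to 0 (inverse of 0); it does not occur in [eta] for r >= 2. *)
Definition laurent_int (i : 'I_l) (a : int) (p : {poly S}) : F :=
  \sum_(j < size p)
    FracField.tofrac p`_j * FracField.tofrac 'X_i ^ (a + j%:Z + 1)
      / (a + j%:Z + 1)%:~R.

Definition lambda (r : nat) : {poly S} :=
  \prod_(i < l) ('X^r - ('X_i ^+ r)%:P).

Definition eta (r m : nat) (u : int) : 'rV[F]_l :=
  \row_(i < l) laurent_int i (r%:Z * u) (lambda r ^+ m).

Definition basis_fields (r m : nat) (k : int) (mbar : 'I_l -> nat)
    (j : 'I_l) : 'rV[F]_l :=
  if val j == 0%N then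
    FracField.tofrac (\prod_(i < l) 'X_i ^+ mbar i) *: eta r m k
  else eta r m (k + (val j)%:Z).

End Eta.

(* Main.v *)
(* For u in Z write eta_u for eta^m_u. Put s = t^r and lambda(s) = prod_i
   (s - x_i^r). The i-th component of eta_u is x_i^(ru+1) P(x_i^r), where P solves
   the Euler equation r s P' + (ru+1) P = lambda^m; this is solvable since r does
   not divide ru+1. Membership in D(A, mu): the integral of
   t^(ru) (t^r - x^r)^a (t^r - y^r)^b q(t^r) from y to x is divisible by
   (x - y)^(a+b+1), by induction on a through
   t^r - x^r = (t^r - y^r) - (x^r - y^r). Basis: by Saito's criterion it suffices
   that the determinant is a nonzero constant times the defining polynomial Q. Q
   divides it, and both have the same degree, so it remains to see that it is
   nonzero. A relation sum_j c_j eta_{k+j} = 0 gives a solution P of the Euler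
   equation with right-hand side c(s) lambda(s)^m, deg c < l, that vanishes at all
   x_i^r; then lambda^(m+1) divides P, hence P = 0 for degree reasons. *)

Require Import Defs.
From HB Require Import structures.
From mathcomp Require Import all_boot all_order all_algebra fraction.
From mathcomp Require Import ring zify.
From mathcomp.multinomials Require Import mpoly.
From mathcomp.real_closed Require Import complex.
From mathcomp Require reals.

Set Implicit Arguments.
Unset Strict Implicit.
Unset Printing Implicit Defensive.

Import reals.Real.Exports.
Import Order.TTheory GRing.Theory Num.Theory.
Local Open Scope ring_scope.

(** * Divisibility in commutative rings *)

Definition divides (R : comNzRingType) (a f : R) : Prop :=
  exists g, f = g * a.

Section Divides.
Variable R : comNzRingType.
Implicit Types a b f g : R.

Lemma divides_refl a : divides a a.
Proof. by exists 1; rewrite mul1r. Qed.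

Lemma dividesD a f g : divides a f -> divides a g -> divides a (f + g).
Proof. by move=> [f' ->] [g' ->]; exists (f' + g'); rewrite mulrDl. Qed.

Lemma divides_mull a f g : divides a f -> divides a (g * f).
Proof. by move=> [f' ->]; exists (g * f'); rewrite mulrA. Qed.

Lemma dividesB a f g : divides a f -> divides a g -> divides a (f - g).
Proof.
by move=> df dg; apply: dividesD => //; rewrite -mulN1r; apply: divides_mull.
Qed.

Lemma dividesM a b f g : divides a f -> divides b g -> divides (a * b) (f * g).
Proof. by move=> [f' ->] [g' ->]; exists (f' * g'); rewrite mulrACA. Qed.

Lemma dividesX a f n : divides a f -> divides (a ^+ n) (f ^+ n).
Proof. by move=> [g ->]; exists (g ^+ n); rewrite exprMn. Qed.

Lemma dividesXn_le a n p : (n <= p)%N -> divides (a ^+ n) (a ^+ p).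
Proof. by move=> np; exists (a ^+ (p - n)); rewrite -exprD subnK. Qed.

End Divides.

(** * Prime elements presented as generators of kernels *)

Section KernelPrime.
Variables R R' : idomainType.

(** This makes [a] prime, since R/(a) embeds in the domain R'. Such a witness takes the place of
    unique factorization, and testing divisibility by [a] becomes applying [phi]. *)
Definition kernel_generated (phi : {rmorphism R -> R'}) (a : R) : Prop :=
  [/\ a != 0, phi a = 0 & forall f, phi f = 0 -> divides a f].

(** The prime [a] does not divide [h], so [phi] must kill [f]; one factor [a] is removed from both
    sides and the argument repeats. *)
Lemma kernel_cancel (phi : {rmorphism R -> R'}) a n f h :
  kernel_generated phi a -> phi h != 0 ->
  divides (a ^+ n) (f * h) -> divides (a ^+ n) f.
Proof.
move=> [a0 pa ker] h0 [g]; elim: n => [|n IHn] in f g *.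
  by move=> _; exists f; rewrite mulr1.
move=> e; have /eqP : phi f * phi h = 0.
  by rewrite -rmorphM e exprS !rmorphM pa mul0r mulr0.
rewrite mulf_eq0 (negbTE h0) orbF => /eqP /ker [f' ef].
have /IHn[g' eg] : f' * h = g * a ^+ n.
  apply: (mulIf a0); move: e; rewrite ef exprSr mulrA => <-.
  by rewrite mulrAC.
by exists g'; rewrite ef eg -mulrA -exprSr.
Qed.

(** Powers of pairwise non-associated primes are collected one by one: [phi t] does not kill the
    product already split off, so [kernel_cancel] moves the power of [a t] to the cofactor. *)
Lemma kernel_prod (T : eqType) (s : seq T) (phi : T -> {rmorphism R -> R'})
    (a : T -> R) (mu : T -> nat) f :
  uniq s -> (forall t, kernel_generated (phi t) (a t)) ->
  (forall t t', t != t' -> phi t (a t') != 0) ->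
  (forall t, t \in s -> divides (a t ^+ mu t) f) ->
  divides (\prod_(t <- s) a t ^+ mu t) f.
Proof.
move=> + ker cop; elim: s => [_ _|t s IHs /= /andP[ts us] df].
  by exists f; rewrite big_nil mulr1.
have [t' t's|g ef] := IHs us; first by apply: df; rewrite inE t's orbT.
rewrite big_cons.
have /(kernel_cancel (ker t) _)[|g' eg] :
    divides (a t ^+ mu t) (g * \prod_(t <- s) a t ^+ mu t).
- by rewrite -ef; apply: df; rewrite mem_head.
- rewrite rmorph_prod prodf_seq_neq0; apply/allP => t' t's /=.
  by rewrite rmorphXn expf_neq0 // cop //; apply: contraNneq ts => ->.
by exists g'; rewrite mulrA -eg.
Qed.

End KernelPrime.

(** * Root multiplicities under the Euler operator *)

Lemma XsubC_kernel (R : idomainType) (y : R) :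
  kernel_generated (horner_eval y) ('X - y%:P).
Proof.
split; rewrite ?polyXsubC_eq0 //; first by rewrite /= /horner_eval !hornerE subrr.
by move=> f /eqP /factor_theorem [q ->]; exists q.
Qed.

(** Let w = X - y. If p = g w^(e+1) with e < b, the operator sends p to w^e times n (e+1) X g plus a
    multiple of w. Divisibility by w^(e+1) gives n (e+1) y g(y) = 0, hence g(y) = 0 in
    characteristic zero, and the order of the root grows until it exceeds b. *)
Lemma euler_root (R : idomainType) (n : nat) (c y : R) (b : nat) (p : {poly R}) :
  [pchar R] =i pred0 -> n != 0%N -> y != 0 -> p.[y] = 0 ->
  divides (('X - y%:P) ^+ b) (n%:R *: ('X * p^`()) + c *: p) ->
  divides (('X - y%:P) ^+ b.+1) p.
Proof.
move=> ch0 n0 y0 py.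
have nR0 k : k != 0%N -> k%:R != 0 :> R by rewrite ((pcharf0P R).1 ch0).
suff H e : (e <= b)%N -> divides (('X - y%:P) ^+ b) (n%:R *: ('X * p^`()) + c *: p) ->
    divides (('X - y%:P) ^+ e.+1) p by exact: H.
elim: e => [_ _|e IHe eb db].
  by rewrite expr1; move/eqP/factor_theorem: py.
have [g eg] := IHe (ltnW eb) db.
set w := 'X - y%:P in eg db *.
have w0 : w != 0 by rewrite polyXsubC_eq0.
have [q eq] : divides w (n%:R *: ('X * (g^`() * w + g *+ e.+1)) + c *: (g * w)).
  case: db => q; rewrite -(subnK eb) addnS exprS exprD => eqb.
  exists (q * w ^+ (b - e.+1)); apply: (mulIf (expf_neq0 e w0)).
  transitivity (n%:R *: ('X * p^`()) + c *: p); last first.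
    by rewrite eqb -!mulrA; congr (_ * _); rewrite mulrCA.
  rewrite eg derivM deriv_exp derivXsubC mul1r /= exprS -!mul_polyC.
  rewrite -[g *+ _]mulr_natr -[_ ^+ e *+ _]mulr_natr.
  by move: (e.+1%:R) (n%:R%:P) (w ^+ e) => a d u; ring.
have /eqP : n%:R * (y * (g.[y] *+ e.+1)) = 0.
  have /(congr1 (horner^~ y)) := eq.
  by rewrite /w !hornerE subrr !(mulr0, add0r, addr0) hornerMn /= mulr0 addr0.
rewrite -[g.[y] *+ _]mulr_natr !mulf_eq0 (negbTE (nR0 _ n0)) (negbTE y0) /=.
rewrite (negbTE (nR0 e.+1 isT)) orbF.
by case/factor_theorem => g1 eg1; exists g1; rewrite eg eg1 -mulrA -exprS.
Qed.

Lemma pchar_mpoly0 (K : numDomainType) (l : nat) : [pchar {mpoly K[l]}] =i pred0.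
Proof.
by apply/pcharf0P => n; rewrite -(mpolyC_nat l K) mpolyC_eq0 pnatr_eq0.
Qed.

Lemma mulX_derivXn (R : comNzRingType) n :
  'X * ('X^n : {poly R})^`() = n%:R *: 'X^n.
Proof.
case: n => [|n]; first by rewrite derivXn mulr0n mulr0 scale0r.
by rewrite derivXn /= mulrnAr -exprS scaler_nat.
Qed.

Lemma mulX_deriv_comp_Xn (R : comNzRingType) (p : {poly R}) r :
  'X * (p \Po 'X^r)^`() = r%:R *: (('X * p^`()) \Po 'X^r).
Proof.
by rewrite deriv_comp mulrCA mulX_derivXn comp_polyM comp_polyX -scalerAr mulrC.
Qed.

(** * Integration as the inverse of an Euler operator *)

Section EulerIntegral.
Variables (K : numFieldType) (l r : nat).
Local Notation S := {mpoly K[l]}.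

(* With s = t ^ r, the antiderivative of [t ^ (e - 1) * p (t ^ r)] is
   [t ^ e * (euler_int e p) (t ^ r)]. *)
Definition euler_int (e : int) (p : {poly S}) : {poly S} :=
  \poly_(j < size p) ((r%:Z * j%:Z + e)%:~R^-1 *: p`_j).

Lemma coef_euler_int e p j :
  (euler_int e p)`_j = (r%:Z * j%:Z + e)%:~R^-1 *: p`_j.
Proof.
by rewrite coef_poly; case: ltnP => // sj; rewrite nth_default ?scaler0.
Qed.

Lemma size_euler_int e p : (size (euler_int e p) <= size p)%N.
Proof. exact: size_poly. Qed.

Lemma euler_intD e : {morph euler_int e : p q / p + q}.
Proof. by move=> p q; apply/polyP => j; rewrite !(coefD, coef_euler_int) scalerDr. Qed.

Lemma euler_intZ e c p : euler_int e (c *: p) = c *: euler_int e p.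
Proof. by apply/polyP => j; rewrite !(coefZ, coef_euler_int) scalerAr. Qed.

Lemma euler_intB e : {morph euler_int e : p q / p - q}.
Proof. by move=> p q; rewrite -scaleN1r euler_intD euler_intZ scaleN1r. Qed.

Lemma euler_intXM e p : euler_int e ('X * p) = 'X * euler_int (e + r%:Z) p.
Proof.
apply/polyP => [[|j]]; rewrite coef_euler_int !coefXM ?scaler0 //=.
by rewrite coef_euler_int; congr (_%:~R^-1 *: _); rewrite -[in LHS]addn1 PoszD; ring.
Qed.

Lemma euler_intXnM e n p :
  euler_int e ('X^n * p) = 'X^n * euler_int (e + r%:Z * n%:Z) p.
Proof.
elim: n e => [|n IHn] e; first by rewrite !mul1r mulr0 addr0.
rewrite exprS -!mulrA euler_intXM IHn; congr (_ * (_ * euler_int _ _)).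
by rewrite -[in RHS]addn1 PoszD; ring.
Qed.

Lemma euler_int_sum e n (F : 'I_n -> {poly S}) :
  euler_int e (\sum_(j < n) F j) = \sum_(j < n) euler_int e (F j).
Proof.
have e0 : euler_int e 0 = 0 by apply/polyP => j; rewrite coef_euler_int coef0 scaler0.
exact: (big_morph _ (euler_intD e) e0).
Qed.

(** The operator is diagonal on powers of X, with eigenvalue r j + e on X^j. *)
Lemma euler_intK e p : (forall j : nat, r%:Z * j%:Z + e != 0) ->
  r%:R *: ('X * (euler_int e p)^`()) + e%:~R *: euler_int e p = p.
Proof.
move=> nz; apply/polyP => j; rewrite coefD !coefZ coefXM coef_deriv.
set c := (euler_int e p)`_j.
transitivity ((r%:Z * j%:Z + e)%:~R * c).
  rewrite intrD intrM !mulrDl; congr (_ + _); rewrite -mulrA; congr (_ * _).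
  case: j @c => [|j] c /=; first by rewrite mul0r.
  by rewrite mulr_natl.
by rewrite /c coef_euler_int mulrzl -scaler_int scalerA divff ?intr_eq0 // scale1r.
Qed.

(** One factor X - y is split into its two terms; evaluated at y, each contributes a factor y. The
    induction varies [e] because extracting X shifts it. With y = x_i^r this yields the power of x_i
    that compensates the pole. *)
Lemma euler_int_root e m y h :
  divides (y ^+ m) (euler_int e (('X - y%:P) ^+ m * h)).[y].
Proof.
elim: m e h => [|m IHm] e h; first by eexists; rewrite mulr1.
have -> : ('X - y%:P) ^+ m.+1 * h =
    'X * (('X - y%:P) ^+ m * h) - y *: (('X - y%:P) ^+ m * h).
  by rewrite exprS -mul_polyC; ring.
rewrite euler_intB euler_intXM euler_intZ hornerD hornerN hornerM hornerX hornerZ.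
rewrite exprS; apply: dividesB; apply: dividesM => //; exact: divides_refl.
Qed.

Section Difference.
Variables (e : int) (A B : nat) (x y : S).
Hypotheses (AB : A%:Z = B%:Z + e) (y0 : y != 0).
Hypothesis nz : forall j : nat, r%:Z * j%:Z + e != 0.

(* [(x y) ^ B] times the integral of [t ^ (e - 1) * p (t ^ r)] from y to x. *)
Definition euler_diff (p : {poly S}) : S :=
  x ^+ A * y ^+ B * (euler_int e p).[x ^+ r] -
  y ^+ A * x ^+ B * (euler_int e p).[y ^+ r].

(** With x replaced by an indeterminate, the difference becomes a polynomial f with f(y) = 0 and X
    f' - B f = y^B X^A p(X^r). The right side is divisible by (X - y)^b, so [euler_root] applies
    with n = 1 and c = -B. *)
Lemma euler_diff_base b q :
  divides ((x - y) ^+ b.+1) (euler_diff (('X - (y ^+ r)%:P) ^+ b * q)).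
Proof.
set p := _ * q; pose P := euler_int e p.
pose f : {poly S} := y ^+ B *: ('X^A * (P \Po 'X^r)) - (y ^+ A * P.[y ^+ r]) *: 'X^B.
have fy : f.[y] = 0.
  by rewrite /f !(hornerE, horner_comp, hornerXn) /=; ring.
have [|g eg] := @euler_root _ 1 (- B%:R) y b f (@pchar_mpoly0 _ _) isT y0 fy.
  have -> : 1%:R *: ('X * f^`()) + - B%:R *: f = y ^+ B *: ('X^A * (p \Po 'X^r)).
    have -> : p = r%:R *: ('X * P^`()) + e%:~R *: P by rewrite euler_intK.
    have eE : e%:~R = A%:R - B%:R :> S.
      by rewrite -[A%:R]/(A%:Z%:~R) AB intrD addrC addKr.
    have XfE : 'X * f^`() = y ^+ B *: (A%:R *: 'X^A * (P \Po 'X^r) +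
        'X^A * (r%:R *: (('X * P^`()) \Po 'X^r))) -
        (y ^+ A * P.[y ^+ r]) *: (B%:R *: 'X^B).
      rewrite -!mulX_derivXn -mulX_deriv_comp_Xn // /f derivB !derivZ derivM -!mul_polyC.
      by move: (_ \Po _) => Q; move: (Q^`()) => Q'; ring.
    rewrite scale1r XfE /f eE comp_polyD !comp_polyZ -!mul_polyC !polyCB polyCN.
    by move: (P \Po 'X^r) ('X * P^`() \Po 'X^r) => Q Q1; ring.
  rewrite -mul_polyC mulrA; apply: divides_mull.
  rewrite /p comp_polyM; rewrite mulrC; apply: divides_mull.
  rewrite rmorphXn rmorphB /= comp_polyX comp_polyC; apply: dividesX.
  by apply/factor_theorem; rewrite rootE !hornerE subrr.
exists g.[x]; have /(congr1 (horner^~ x)) := eg.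
rewrite /f !(hornerE, horner_comp, hornerXn) /= => <-.
by rewrite /euler_diff; ring.
Qed.

Lemma split_factor (X Y : {poly S}) a b q c : X = Y - c%:P ->
  X ^+ a.+1 * (Y ^+ b * q) = X ^+ a * (Y ^+ b.+1 * q) - c *: (X ^+ a * (Y ^+ b * q)).
Proof.
by move=> eX; rewrite exprS {1}eX exprS -mul_polyC; move: (X ^+ a) (Y ^+ b) => U V; ring.
Qed.

Lemma euler_diff_divides a b q : divides ((x - y) ^+ (a + b).+1)
  (euler_diff (('X - (x ^+ r)%:P) ^+ a * (('X - (y ^+ r)%:P) ^+ b * q))).
Proof.
elim: a b q => [|a IHa] b q; first by rewrite mul1r; apply: euler_diff_base.
have eX : 'X - (x ^+ r)%:P = ('X - (y ^+ r)%:P) - (x ^+ r - y ^+ r)%:P.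
  by rewrite polyCB opprB addrA subrK.
apply: (eq_ind_r (fun p => divides _ (euler_diff p)) _ (split_factor a b q eX)).
have -> u v c : euler_diff (u - c *: v) = euler_diff u - c * euler_diff v.
  by rewrite /euler_diff euler_intB euler_intZ !hornerE; ring.
(* The first term trades a factor at x^r for one at y^r, keeping a + b; the second has one factor
   fewer but gains x - y from x^r - y^r. *)
apply: dividesB; first by rewrite addSn -addnS; apply: IHa.
rewrite addSn exprS; apply: dividesM; last exact: IHa.
by rewrite subrXX mulrC; eexists.
Qed.

End Difference.

End EulerIntegral.

(** * Linear forms as primes of the polynomial ring *)

Section LinearForms.
Variables (K : fieldType) (l : nat).
Local Notation S := {mpoly K[l]}.
Implicit Types a b : 'rV[K]_l.

Lemma mcoeff_linform a i : (linform a)@_U_(i) = a 0 i.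
Proof.
rewrite /linform raddf_sum (bigD1 i) //= linearZ /= mcoeffXU eqxx.
rewrite big1 /= ?addr0 ?mulr1 // => j ji.
by rewrite linearZ /= mcoeffXU (negbTE ji) mulr0.
Qed.

Lemma linform_eq0 a : linform a = 0 -> a = 0.
Proof. by move=> a0; apply/rowP => i; rewrite -mcoeff_linform a0 mcoeff0 mxE. Qed.

(** Supported at one pivot of [a] and normalised so that its pairing with a nonzero [a] is 1; this
    makes [elim_form a] kill [linform a]. *)
Definition elim_coef a (k : 'I_l) : K :=
  if [pick i | a 0 i != 0] is Some i then (k == i)%:R / a 0 i else 0.

(* Eliminates a variable by means of the equation [linform a = 0]. *)
Definition elim_form a : {rmorphism S -> S} :=
  comp_mpoly [tuple 'X_k - elim_coef a k *: linform a | k < l].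

Lemma elim_formX a k : elim_form a 'X_k = 'X_k - elim_coef a k *: linform a.
Proof. by rewrite /= comp_mpolyXU -tnth_nth tnth_mktuple. Qed.

Lemma elim_form_linform a b :
  elim_form a (linform b) =
    linform (b - (\sum_k b 0 k * elim_coef a k) *: a).
Proof.
rewrite linformBZ {1 2}/linform raddf_sum scaler_suml -sumrB.
apply: eq_bigr => k _; rewrite /= comp_mpolyZ -[_ \mPo _]/(elim_form a 'X_k).
by rewrite elim_formX scalerBr scalerA.
Qed.

Lemma elim_form_neq0 a b : (forall c, b != c *: a) -> elim_form a (linform b) != 0.
Proof.
move=> nab; rewrite elim_form_linform; apply/eqP => /linform_eq0 /eqP.
by rewrite subr_eq0 (negbTE (nab _)).
Qed.

(** The substitution moves every variable by a multiple of [linform a], so f and its image are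
    always congruent modulo [linform a]; if the image is 0, the form divides f. *)
Lemma elim_form_kernel a : a != 0 -> kernel_generated (elim_form a) (linform a).
Proof.
move=> a0; split; first by apply: contra_neq a0; apply: linform_eq0.
  rewrite elim_form_linform /elim_coef; case: pickP => [i ai|z]; last first.
    by case/eqP: a0; apply/rowP => i; rewrite mxE; apply/eqP/negbFE/z.
  rewrite (bigD1 i) //= eqxx mul1r divff // big1 => [|k /negbTE ->].
    by rewrite addr0 scale1r subrr /linform big1 // => j _; rewrite mxE scale0r.
  by rewrite mul0r mulr0.
move=> f f0; suff : divides (linform a) (f - elim_form a f) by rewrite f0 subr0.
elim/mpolyind: f {f0} => [|c m p _ _ IHp].
  by exists 0; rewrite raddf0 subr0 mul0r.
rewrite rmorphD opprD addrACA; apply: dividesD => //.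
rewrite /= comp_mpolyZ -scalerBr -mul_mpolyC; apply: divides_mull.
rewrite -[_ \mPo _]/(elim_form a 'X_[m]) mpolyXE_id rmorph_prod.
elim/big_ind2: _ => [|u u' v v' du dv|k _]; first by exists 0; rewrite subrr mul0r.
  (* Congruence modulo the form is compatible with products. *)
  have -> : u * v - u' * v' = v * (u - u') + u' * (v - v') by ring.
  by apply: dividesD; apply: divides_mull.
rewrite rmorphXn subrXX mulrC; apply: divides_mull.
by rewrite elim_formX opprB addrCA subrr addr0 -mul_mpolyC; eexists.
Qed.

Lemma der_apply_linform (d : 'rV[S]_l) a :
  der_apply d (linform a) = \sum_(i < l) a 0 i *: d 0 i.
Proof.
apply: eq_bigr => i _; rewrite /linform raddf_sum (bigD1 i) //= mderivZ mderivX.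
rewrite mnm1E eqxx scale1r -{1}[U_(i)%MM]add0m addmK mpolyX0 big1 ?addr0 => [|j ji].
  by rewrite -scalerAr mulr1.
by rewrite mderivZ mderivX mnm1E (negbTE ji) scale0r scaler0.
Qed.

End LinearForms.

(** * Saito's criterion *)

Section Saito.
Variables (K : fieldType) (l : nat) (A : multiarrangement K l).
Local Notation S := {mpoly K[l]}.

Lemma defining_poly_divides (f : S) :
  (forall H : hidx A, divides (hform H ^+ hmult H) f) ->
  divides (defining_poly A) f.
Proof.
move=> df; apply: (@kernel_prod _ _ _ _ (fun H => elim_form (hcoef H))).
- exact: index_enum_uniq.
- by move=> H; apply/elim_form_kernel/hcoef_neq0.
- by move=> H H' HH'; apply: elim_form_neq0 => c; rewrite hcoef_ncol // eq_sym.
- by move=> H _; apply: df.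
Qed.

(** Applied to the coefficient vector of a form, M gives a vector divisible by the required power of
    that form. Multiplying by the adjugate shows that det M times a nonzero scalar coefficient is
    divisible too. *)
Lemma logder_det_divides (M : 'M[S]_l) :
  (forall j, logder A (row j M)) -> divides (defining_poly A) (\det M).
Proof.
move=> DM; apply: defining_poly_divides => H.
have [i ai] : exists i, hcoef H 0 i != 0.
  apply/existsP; apply: contraNT (hcoef_neq0 H) => /existsPn a0.
  by apply/eqP/rowP => i; rewrite mxE; apply/eqP/negbNE/a0.
have [h hE] : exists h : 'cV[S]_l, M *m (map_mx (@mpolyC l K) (hcoef H))^T =
    (hform H ^+ hmult H) *: h.
  have [h hE] := fin_all_exists (fun j => DM j H).
  exists (\col_j h j); apply/colP => j; rewrite !mxE mulrC -hE der_apply_linform.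
  by apply: eq_bigr => k _; rewrite !mxE -mul_mpolyC mulrC.
have /(congr1 (fun v => (hcoef H 0 i)^-1 *: (\adj M *m v) i 0)) := hE.
rewrite mulmxA mul_adj_mx mul_scalar_mx -scalemxAr !mxE mulrC mul_mpolyC scalerA.
rewrite mulVf // scale1r => ->; rewrite scalerAr mulrC; by eexists.
Qed.

Lemma saito_criterion (M : 'M[S]_l) (c : K) :
  (forall j, logder A (row j M)) -> c != 0 -> \det M = c *: defining_poly A ->
  is_module_basis (logder A) (fun j => row j M).
Proof.
move=> DM c0 detM; split=> // [v Dv|w wM j].
  (* Cramer's rule: [N j] is M with row j replaced by v. All its rows are logarithmic, so its
     determinant is a multiple [w j] of Q, and since det M = c Q the coordinates of v are the [w j]
     divided by c. *)
  pose N j : 'M[S]_l := \matrix_i (if i == j then v else row i M).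
  have [w wE] : exists w : 'I_l -> S, forall j, \det (N j) = w j * defining_poly A.
    apply: (@fin_all_exists _ (fun=> S) (fun j w => \det (N j) = w * _)) => j.
    apply: logder_det_divides => i.
    by rewrite rowK; case: eqP.
  have adjE : v *m \adj M = \row_j \det (N j).
    apply/rowP => j; rewrite !mxE (expand_det_row _ j); apply: eq_bigr => i _.
    rewrite !mxE eqxx; congr (_ * ((-1) ^+ _ * \det _)).
    by apply/matrixP => i1 i2; rewrite !mxE eq_sym (negbTE (neq_lift _ _)) mxE.
  exists (fun j => c^-1 *: w j).
  have Q0 : defining_poly A != 0.
    rewrite prodf_seq_neq0; apply/allP => H _ /=; rewrite expf_neq0 //.
    by case: (elim_form_kernel (hcoef_neq0 H)).
  have detM0 : \det M != 0 by rewrite detM scaler_eq0 negb_or c0.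
  suff E : \det M *: v = \det M *: \sum_(j < l) (c^-1 *: w j) *: row j M.
    apply/rowP => i; have /rowP/(_ i) := E.
    by rewrite [LHS]mxE [RHS]mxE => /(mulfI detM0).
  rewrite -[LHS]mul_mx_scalar -mul_adj_mx mulmxA adjE.
  rewrite mulmx_sum_row scaler_sumr; apply: eq_bigr => j _.
  rewrite mxE wE scalerA detM -scalerAl -scalerAr scalerA divff // scale1r.
  by rewrite [w j * _]mulrC.
(* Independence: the adjugate turns a relation into det M times its coefficient vector. *)
have := congr1 (mulmx^~ (\adj M)) (_ : (\row_j w j) *m M = 0).
rewrite /= -mulmxA mul_mx_adj mul0mx mul_mx_scalar => H.
have /rowP/(_ j) : \det M *: \row_j w j = 0.
  by apply: H; rewrite mulmx_sum_row -[RHS]wM; apply: eq_bigr => i _; rewrite mxE.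
have detM0 : \det M != 0.
  rewrite detM scaler_eq0 negb_or c0 prodf_seq_neq0; apply/allP => H' _ /=.
  by rewrite expf_neq0 //; case: (elim_form_kernel (hcoef_neq0 H')).
by rewrite !mxE => /eqP; rewrite mulf_eq0 (negbTE detM0) => /eqP.
Qed.

End Saito.

(** * Homogeneity through doubling of the variables *)

Section Scaling.
Variables (K : numFieldType) (l : nat).
Local Notation S := {mpoly K[l]}.

(** One substitution suffices to read off degrees, because the powers of 2 are distinct in
    characteristic zero. *)
Definition double_vars : {rmorphism S -> S} :=
  comp_mpoly [tuple 2%:R *: 'X_k | k < l].

(* Holds in particular for f homogeneous of degree d. *)
Definition scales (d : nat) (f : S) : Prop := double_vars f = 2%:R ^+ d *: f.

Lemma scalesX i : scales 1 'X_i.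
Proof. by rewrite /scales /= comp_mpolyXU -tnth_nth tnth_mktuple. Qed.

Lemma scales1 : scales 0 1.
Proof. by rewrite /scales rmorph1 scale1r. Qed.

Lemma scalesD d f g : scales d f -> scales d g -> scales d (f + g).
Proof. by rewrite /scales rmorphD => -> ->; rewrite scalerDr. Qed.

Lemma scalesZ d c f : scales d f -> scales d (c *: f).
Proof. by rewrite /scales /= comp_mpolyZ => ->; rewrite !scalerA mulrC. Qed.

Lemma scales_sum (I : Type) (s : seq I) (P : pred I) (F : I -> S) d :
  (forall i, P i -> scales d (F i)) -> scales d (\sum_(i <- s | P i) F i).
Proof.
move=> sF; elim/big_ind: _ => //; last exact: scalesD.
by rewrite /scales rmorph0 scaler0.
Qed.

Lemma scalesB d f g : scales d f -> scales d g -> scales d (f - g).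
Proof. by move=> sf sg; rewrite -scaleN1r; apply: scalesD => //; apply: scalesZ. Qed.

Lemma scalesM d d' f g : scales d f -> scales d' g -> scales (d + d') (f * g).
Proof.
rewrite /scales rmorphM => -> ->.
by rewrite -scalerAl -scalerAr scalerA exprD.
Qed.

Lemma scales_exp d f p : scales d f -> scales (d * p) (f ^+ p).
Proof.
move=> sf; elim: p => [|p IHp]; first by rewrite muln0; apply: scales1.
by rewrite exprS mulnS; apply: scalesM.
Qed.

Lemma scales_prod (I : Type) (s : seq I) (P : pred I) (F : I -> S) (d : I -> nat) :
  (forall i, P i -> scales (d i) (F i)) ->
  scales (\sum_(i <- s | P i) d i) (\prod_(i <- s | P i) F i).
Proof.
by move=> sF; elim/big_ind2: _ => //; [apply: scales1|move=> *; apply: scalesM].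
Qed.

Lemma scales_det n (M : 'M[S]_n) (d : 'I_n -> nat) :
  (forall i j, scales (d i) (M i j)) -> scales (\sum_i d i) (\det M).
Proof.
move=> sM; apply: scales_sum => s _; rewrite mulr_sign.
by case: ifP => _; rewrite -?scaleN1r; [apply: scalesZ|]; apply: scales_prod.
Qed.

Lemma double_vars_mcoeff f u : (double_vars f)@_u = 2%:R ^+ mdeg u * f@_u.
Proof.
elim/mpolyind: f => [|c v p _ _ IHp]; first by rewrite rmorph0 mcoeff0 mulr0.
rewrite rmorphD !mcoeffD IHp mulrDr; congr (_ + _).
rewrite /= comp_mpolyZ !mcoeffZ -[_ \mPo _]/(double_vars 'X_[v]).
have -> : double_vars 'X_[v] = 2%:R ^+ mdeg v *: 'X_[v].
  rewrite mpolyXE_id mdegE; apply: scales_prod => i _.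
  by have := scales_exp (v i) (scalesX i); rewrite mul1n.
rewrite mcoeffZ mcoeffX; case: eqP => [->|_]; first by rewrite mulrCA.
by rewrite !mulr0.
Qed.

(** Each coefficient in degree d satisfies 2^d c = c, which forces c = 0 unless d = 0. *)
Lemma scales0_const f : scales 0 f -> exists c, f = c%:MP.
Proof.
move=> sf; exists f@_0; apply/mpolyP => u; rewrite mcoeffC.
have [<-|u0] := eqVneq 0%MM u; first by rewrite mulr1.
rewrite mulr0; have := double_vars_mcoeff f u; rewrite sf scale1r => /eqP.
rewrite -subr_eq0 -{1}[f@_u]mul1r -mulrBl mulf_eq0 => /orP[|/eqP //].
rewrite subr_eq0 eq_sym -natrX pnatr_eq1 -(expn0 2) eqn_exp2l // mdeg_eq0.
by rewrite eq_sym (negbTE u0).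
Qed.

Lemma scales_quotient d f g : g != 0 -> scales d g -> scales d (f * g) ->
  exists c, f = c%:MP.
Proof.
move=> g0 sg; rewrite /scales rmorphM sg => /eqP.
rewrite -scalerAr (inj_eq (scalerI _)) ?expf_neq0 ?pnatr_eq0 // => /eqP.
move/(mulIf g0) => e; apply: scales0_const.
by rewrite /scales scale1r.
Qed.

End Scaling.

Lemma mpolyU_neq0 (K : nzRingType) (l : nat) (i : 'I_l) :
  ('X_i : {mpoly K[l]}) != 0.
Proof. by rewrite -msupp_eq0 msuppX. Qed.

(** * The Laurent integral in terms of [euler_int] *)

Section LaurentIntegral.
Variables (K : numFieldType) (l r : nat).
Local Notation S := {mpoly K[l]}.
Local Notation tofrac := (@FracField.tofrac {mpoly K[l]}).

Lemma tofracZ (c : K) (f : S) : tofrac (c *: f) = tofrac c%:MP * tofrac f.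
Proof. by rewrite -mul_mpolyC rmorphM. Qed.

Lemma tofrac_inv_int (z : int) : tofrac (z%:~R^-1 : K)%:MP = z%:~R^-1.
Proof.
pose f := (@FracField.tofrac S \o @mpolyC l K : {rmorphism K -> {fraction S}}).
by rewrite -[LHS]/(f _) fmorphV rmorph_int.
Qed.

(** The longer range lets polynomials of different sizes share one index set, as additivity
    requires. *)
Lemma laurent_int_wide (i : 'I_l) a (p : {poly S}) N : (size p <= N)%N ->
  laurent_int i a p = \sum_(j < N) tofrac p`_j * tofrac 'X_i ^ (a + j%:Z + 1)
                        / (a + j%:Z + 1)%:~R.
Proof.
move=> pN; pose F j := tofrac p`_j * tofrac 'X_i ^ (a + j%:Z + 1) / (a + j%:Z + 1)%:~R.
rewrite /laurent_int (big_ord_widen N F pN) [RHS](bigID (fun j : 'I_N => (j < size p)%N)) /=.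
rewrite [X in _ = _ + X]big1 ?addr0 // => j; rewrite -leqNgt => pj.
by rewrite nth_default // rmorph0 !mul0r.
Qed.

Lemma laurent_intD (i : 'I_l) a : {morph laurent_int (K := K) i a : p q / p + q}.
Proof.
move=> p q; pose N := maxn (size p) (size q).
rewrite (laurent_int_wide i a (leq_maxl (size p) (size q) : (_ <= N)%N)).
rewrite (laurent_int_wide i a (leq_maxr (size p) (size q) : (_ <= N)%N)).
rewrite (laurent_int_wide i a (size_polyD p q : (_ <= N)%N)) -big_split.
by apply: eq_bigr => j _; rewrite coefD rmorphD !mulrDl.
Qed.

Lemma laurent_int_monomial (i : 'I_l) a (c : S) n :
  laurent_int i a (c *: 'X^n) =
    tofrac c * tofrac 'X_i ^ (a + n%:Z + 1) / (a + n%:Z + 1)%:~R.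
Proof.
rewrite (@laurent_int_wide _ _ _ n.+1); last first.
  by rewrite (leq_trans (size_scale_leq _ _)) // size_polyXn.
rewrite (bigD1 ord_max) //= coefZ coefXn eqxx mulr1 big1 ?addr0 // => j jn.
by rewrite coefZ coefXn (negbTE (_ : (j : nat) != n)) // mulr0 rmorph0 !mul0r.
Qed.

(** The term s^j becomes t^(r j), whose integral has exponent (a + 1) + r j. Any pole is thus
    confined to the prefactor x_i^(a+1). *)
Lemma laurent_int_comp (i : 'I_l) a (p : {poly S}) :
  laurent_int i a (p \Po 'X^r) =
    tofrac 'X_i ^ (a + 1) * tofrac (euler_int r (a + 1) p).['X_i ^+ r].
Proof.
have X0 : tofrac 'X_i != 0 by rewrite tofrac_eq0 mpolyU_neq0.
rewrite comp_polyE (big_morph _ (laurent_intD i a) (_ : laurent_int i a 0 = 0)); last first.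
  by rewrite /laurent_int size_poly0 big_ord0.
rewrite horner_poly rmorph_sum mulr_sumr; apply: eq_bigr => j _.
rewrite -exprM laurent_int_monomial -scalerAl /= tofracZ tofrac_inv_int -exprM.
rewrite [tofrac (p`_j * _)]rmorphM /= rmorphXn /=.
have -> : a + (r * j)%N%:Z + 1 = (a + 1) + (r * j)%N%:Z by ring.
have -> : r%:Z * j%:Z + (a + 1) = (a + 1) + (r * j)%N%:Z by rewrite PoszM; ring.
rewrite expfzDr // -exprnP.
by move: (tofrac _ ^ _) (_^-1) (tofrac p`_j) (_ ^+ _) => u v w t; ring.
Qed.

End LaurentIntegral.

(** * The coefficient matrix of the vector fields *)

Section Fields.
Variables (K : numFieldType) (l r m n : nat) (mbar mu : 'I_l -> nat).
Hypothesis r_gt1 : (1 < r)%N.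
(** With n = k + m + 1 this is m_i = r (m + k) + 1 + mbar_i, written without subtraction. *)
Hypothesis muE : forall i, (mu i + r = r * n + 1 + mbar i)%N.
Hypothesis mbar_le : forall i, (mbar i <= r - 1)%N.
Local Notation S := {mpoly K[l]}.

Let r_gt0 : (0 < r)%N := ltnW r_gt1.

(* Here k = n - m - 1; the fields are written on the common denominator
   [x_i ^ pole], and [x_i ^ top j] is the resulting numerator power. *)
Let pole : nat := (r * m.+1)%N.
Let top (j : 'I_l) : nat := (r * (n + j) + 1)%N.
(** This is r (k + j) + 1, the Euler exponent of the field eta_(k+j). *)
Let wt (j : 'I_l) : int := (top j)%:Z - pole%:Z.

Definition lambda_s : {poly S} := \prod_(i < l) ('X - ('X_i ^+ r)%:P).

Lemma lambda_comp : lambda K l r = lambda_s \Po 'X^r.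
Proof.
rewrite /lambda /lambda_s rmorph_prod; apply: eq_bigr => i _.
by rewrite rmorphB /= comp_polyX comp_polyC.
Qed.

Lemma lambda_s_factor (i : 'I_l) : exists h,
  lambda_s = ('X - ('X_i ^+ r)%:P) * h.
Proof. by rewrite /lambda_s (bigD1 i) //=; eexists. Qed.

Lemma lambda_s_factor2 (i j : 'I_l) : i != j -> exists h,
  lambda_s = ('X - ('X_i ^+ r)%:P) * (('X - ('X_j ^+ r)%:P) * h).
Proof.
by move=> ij; rewrite /lambda_s (bigD1 i) //= (bigD1 j) 1?eq_sym //=; eexists.
Qed.

Lemma top_wt j : (top j)%:Z = pole%:Z + wt j.
Proof. by rewrite /wt addrC subrK. Qed.

Lemma wt_neq0 j (s : nat) : r%:Z * s%:Z + wt j != 0.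
Proof.
have nd : ~~ (r %| 1)%N by rewrite dvdn1 gtn_eqF.
apply: contraNneq nd; rewrite /wt /top /pole => /eqP e.
have {e} /eqP[e] : (r * (s + n + j) + 1)%N%:Z == (r * m.+1)%N%:Z :> int.
  by rewrite -subr_eq0; apply: etrans e; congr (_ == _); rewrite !(PoszD, PoszM); ring.
have : (r %| r * (s + n + j) + 1)%N by rewrite e dvdn_mulr.
by rewrite dvdn_addr // dvdn_mulr.
Qed.

Definition mono_factor (j : 'I_l) : S :=
  if val j == 0%N then \prod_i 'X_i ^+ mbar i else 1.

Let prim j : {poly S} := euler_int r (wt j) (lambda_s ^+ m).

(* The matrix of the vector fields, up to the column factors [x_i ^ pole]. *)
Definition eta_matrix (theta : 'M[S]_l) : Prop := forall j i,
  'X_i ^+ pole * theta j i =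
    mono_factor j * ('X_i ^+ top j * (prim j).['X_i ^+ r]).

(** By [euler_int_root] the numerator contains x_i to the power [top j] + r m. After division by
    x_i^pole, row 0 keeps exactly [mu i] thanks to its factor x_i^(mbar i). A row j > 0 keeps r (n +
    j - 1) + 1, which exceeds [mu i] because mbar_i <= r - 1. *)
Lemma eta_matrix_exists : exists2 theta : 'M[S]_l,
  eta_matrix theta & forall j i, divides ('X_i ^+ mu i) (theta j i).
Proof.
have H j i : exists f : S,
    'X_i ^+ pole * f = mono_factor j * ('X_i ^+ top j * (prim j).['X_i ^+ r]) /\
    divides ('X_i ^+ mu i) f.
  have [h hE] := lambda_s_factor i.
  have [g gE] := euler_int_root r (wt j) m ('X_i ^+ r) (h ^+ m).
  rewrite -exprMn -hE in gE; rewrite /prim gE /mono_factor.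
  have [j0|j0] := eqVneq (val j) 0%N.
    pose U : S := \prod_(i' < l | i' != i) 'X_i' ^+ mbar i'.
    exists (U * g * 'X_i ^+ mu i); split; last by eexists.
    rewrite (bigD1 i) //= -/U.
    have -> : 'X_i ^+ pole * (U * g * 'X_i ^+ mu i) = U * g * 'X_i ^+ (pole + mu i).
      by rewrite (exprD _ pole); ring.
    have -> : (pole + mu i = mbar i + (top j + r * m))%N.
      by rewrite /pole /top -[val j]/(nat_of_ord j) in j0 *; have := muE i; rewrite j0; lia.
    by rewrite (exprD _ (mbar i)) (exprD _ (top j)) (exprM _ r m); ring.
  exists (g * 'X_i ^+ (r * (n + j.-1) + 1)); split.
    have -> : 'X_i ^+ pole * (g * 'X_i ^+ (r * (n + j.-1) + 1)) =
        g * 'X_i ^+ (pole + (r * (n + j.-1) + 1)) by rewrite (exprD _ pole); ring.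
    have -> : (pole + (r * (n + j.-1) + 1) = top j + r * m)%N.
      rewrite /pole /top; move: j0; rewrite /=; case: (nat_of_ord j) => //= j' _; lia.
    by rewrite (exprD _ (top j)) (exprM _ r m) mul1r; ring.
  apply/divides_mull/dividesXn_le; have := muE i; have := mbar_le i.
  have : (r * n <= r * (n + j.-1))%N by rewrite leq_pmul2l // leq_addr.
  lia.
have [f fP] := fin_all_exists (fun j => fin_all_exists (H j)).
exists (\matrix_(j, i) f j i) => j i; rewrite mxE; by case: (fP j i).
Qed.

Lemma powers_neq (i j : 'I_l) : i != j -> 'X_i ^+ r != 'X_j ^+ r :> S.
Proof.
move=> ij; apply/eqP => /(congr1 (mcoeff (U_(i) *+ r)%MM)).
rewrite !mcoeffXn eqxx; case: eqP => [/mnmP/(_ i)|_ /eqP]; last by rewrite oner_eq0.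
rewrite !mulmnE !mnm1E eqxx [j == i]eq_sym (negbTE ij) => /esym/eqP.
by rewrite mul1n mul0n gtn_eqF.
Qed.

Lemma monic_lambda_sX p : lambda_s ^+ p \is monic.
Proof. by apply: monic_exp; apply: monic_prod => i _; apply: monicXsubC. Qed.

Lemma size_lambda_sX p : size (lambda_s ^+ p) = (l * p).+1.
Proof.
have sl : size lambda_s = l.+1.
  rewrite /lambda_s -big_enum -(big_map (fun i => 'X_i ^+ r) xpredT (fun x => 'X - x%:P)).
  by rewrite size_prod_XsubC size_map size_enum_ord.
have := size_exp lambda_s p; rewrite sl /= => <-.
by rewrite prednK // lt0n size_poly_eq0 monic_neq0 // monic_lambda_sX.
Qed.

Lemma mono_factor_neq0 j : mono_factor j != 0.
Proof.
rewrite /mono_factor; case: ifP => _; last exact: oner_neq0.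
by rewrite prodf_seq_neq0; apply/allP => i _ /=; rewrite expf_neq0 // mpolyU_neq0.
Qed.

Lemma eta_matrix_det_neq0 theta : eta_matrix theta -> \det theta != 0.
Proof.
move=> thE; apply/negP => /det0P[v v0 vth]; case/eqP: v0.
have [l0|l_gt0] := posnP l; first by apply/rowP => -[j jl]; exfalso; rewrite l0 in jl.
pose j0 := Ordinal l_gt0.
(* The monomial of row 0 is absorbed into the coefficients of the relation, which then form the
   polynomial [c] in s. *)
pose w j := v 0 j * mono_factor j.
pose c : {poly S} := \poly_(j < l) (if insub j is Some j' then w j' else 0).
have cE j : c`_(nat_of_ord j) = w j by rewrite coef_poly ltn_ord valK.
pose P := euler_int r (wt j0) (c * lambda_s ^+ m).
(* Since [wt j] = [wt j0] + r j, extracting X^j from the integral turns the exponent [wt j0] into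
   [wt j]. *)
have PE : P = \sum_(j < l) w j *: ('X^j * prim j).
  rewrite /P [c]poly_def mulr_suml euler_int_sum; apply: eq_bigr => j _.
  rewrite valK -scalerAl euler_intZ euler_intXnM; congr (_ *: (_ * euler_int _ _ _)).
  by rewrite /wt /top /pole /= !(PoszD, PoszM); ring.
(* Column i of the relation, multiplied by x_i^pole, is x_i^(top j0) times the value of P at
   x_i^r. *)
have Proot i : P.['X_i ^+ r] = 0.
  have : 'X_i ^+ top j0 * P.['X_i ^+ r] = 0.
    have /rowP/(_ i) := vth; rewrite !mxE => /(congr1 ( *%R ('X_i ^+ pole))).
    rewrite mulr0 mulr_sumr => e; rewrite -[RHS]e PE horner_sum mulr_sumr.
    apply: eq_bigr => j _; rewrite hornerZ hornerM hornerXn [RHS]mulrCA thE /w -exprM.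
    have -> : (top j = top j0 + r * j)%N by rewrite /top /=; lia.
    by rewrite (exprD _ (top j0)); ring.
  by move/eqP; rewrite mulf_eq0 expf_eq0 (negbTE (mpolyU_neq0 K i)) andbF => /eqP.
have PK := euler_intK (c * lambda_s ^+ m) (wt_neq0 j0).
have [g gE] : divides (lambda_s ^+ m.+1) P.
  rewrite /lambda_s -prodrXl.
  apply: (@kernel_prod _ _ _ _ (fun i : 'I_l => horner_eval ('X_i ^+ r : S))
    (fun i => 'X - ('X_i ^+ r)%:P) (fun=> m.+1)).
  - exact: index_enum_uniq.
  - by move=> i; apply: XsubC_kernel.
  - move=> i j ij; rewrite /= /horner_eval !hornerE subr_eq0; exact: powers_neq.
  move=> i _; apply: (@euler_root _ r (wt j0)%:~R) => //.
  - exact: pchar_mpoly0.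
  - by rewrite -lt0n.
  - by rewrite expf_neq0 // mpolyU_neq0.
  rewrite PK; have [h ->] := lambda_s_factor i.
  by apply: divides_mull; apply: dividesX; exists h; apply: mulrC.
have P0 : P = 0.
  rewrite gE; have [->|g0] := eqVneq g 0; first by rewrite mul0r.
  (* The degree of P is below l (m + 1), that of lambda^(m+1). *)
  have : (size P <= l + l * m)%N.
    apply: leq_trans (size_euler_int _ _ _) _; apply: leq_trans (size_polyMleq _ _) _.
    by rewrite size_lambda_sX addnS /= leq_add2r size_poly.
  rewrite gE size_Mmonic ?monic_lambda_sX // size_lambda_sX addnS /=.
  have := size_poly_eq0 g; rewrite (negbTE g0); case: (size g) => // s _.
  by rewrite mulnS; lia.
have c0 : c = 0.
  have := PK; rewrite -/P P0 deriv0 mulr0 !scaler0 addr0 => /esym/eqP.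
  by rewrite mulf_eq0 (negbTE (monic_neq0 (monic_lambda_sX m))) orbF => /eqP.
apply/rowP => j; rewrite mxE; apply/eqP; have /eqP := cE j.
by rewrite c0 coef0 eq_sym mulf_eq0 (negbTE (mono_factor_neq0 j)) orbF.
Qed.

(** For y = z x_i' one has y^r = x_i'^r, so lambda^m vanishes to order m at both x_i^r and y^r. As
    [top j] is 1 and [pole] is 0 modulo r, replacing x_i' by y multiplies its component by z, and
    the difference is an integral from y to x_i with denominators cleared. *)
Lemma eta_matrix_diff theta (i i' j : 'I_l) (z : K) : eta_matrix theta ->
  i != i' -> z ^+ r = 1 -> z != 0 ->
  divides (('X_i - z *: 'X_i') ^+ (2 * m + 1))
    ((theta j i - z *: theta j i') * ('X_i ^+ pole * 'X_i' ^+ pole)).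
Proof.
move=> thE ii' zr z0; set y := z *: 'X_i'.
have yX p : y ^+ (r * p) = 'X_i' ^+ (r * p).
  by rewrite /y exprZn exprM zr expr1n scale1r.
have yr : y ^+ r = 'X_i' ^+ r by have := yX 1%N; rewrite muln1.
have y0 : y != 0 by rewrite scaler_eq0 negb_or z0 mpolyU_neq0.
have [h hE] := lambda_s_factor2 ii'.
have lamE : lambda_s ^+ m =
    ('X - ('X_i ^+ r)%:P) ^+ m * (('X - (y ^+ r)%:P) ^+ m * h ^+ m).
  by rewrite yr hE !exprMn.
have D : divides (('X_i - y) ^+ (m + m).+1)
    (euler_diff r (wt j) (top j) pole 'X_i y (lambda_s ^+ m)).
  by rewrite lamE; apply: euler_diff_divides (top_wt j) y0 (wt_neq0 j) _ _ _.
have -> : (2 * m + 1 = (m + m).+1)%N by lia.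
suff -> : (theta j i - z *: theta j i') * ('X_i ^+ pole * 'X_i' ^+ pole) =
    mono_factor j * euler_diff r (wt j) (top j) pole 'X_i y (lambda_s ^+ m).
  exact: divides_mull.
rewrite /euler_diff -/(prim j) yr.
have -> : y ^+ top j = z *: 'X_i' ^+ top j.
  by rewrite /top !exprD yX !expr1 scalerAr.
have -> : y ^+ pole = 'X_i' ^+ pole by exact: yX.
transitivity ('X_i' ^+ pole * ('X_i ^+ pole * theta j i) -
   z *: ('X_i ^+ pole * ('X_i' ^+ pole * theta j i'))).
  by rewrite -!mul_mpolyC; ring.
by rewrite !thE -!mul_mpolyC; ring.
Qed.

End Fields.

(** * The degree of the determinant *)

Section EtaDegree.
Variables (K : numFieldType) (l r : nat).
Local Notation S := {mpoly K[l]}.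

(* Weighted homogeneity of total degree d in x and s, where s has degree r. *)
Definition wscales (d : nat) (p : {poly S}) : Prop :=
  forall j, 2%:R ^+ (r * j) *: double_vars K l p`_j = 2%:R ^+ d *: p`_j.

Lemma wscalesM d d' p q : wscales d p -> wscales d' q -> wscales (d + d') (p * q).
Proof.
move=> sp sq j; rewrite coefM rmorph_sum !scaler_sumr; apply: eq_bigr => i _.
have -> : (r * j = r * i + r * (j - i))%N by rewrite -mulnDr subnKC // -ltnS.
rewrite rmorphM !exprD; have := sp i; have := sq (j - i)%N.
set u := 2%:R ^+ (r * i); set v := 2%:R ^+ (r * (j - i)).
move=> eq ep; transitivity ((u *: double_vars K l p`_i) * (v *: double_vars K l q`_(j - i))).
  by rewrite -scalerAl -scalerAr scalerA.
by rewrite eq ep -scalerAl -scalerAr scalerA.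
Qed.

Lemma wscales1 : wscales 0 1.
Proof.
move=> [|j]; rewrite coef1 /= ?rmorph0 ?scaler0 // muln0 rmorph1.
by [].
Qed.

Lemma wscales_factor i : wscales r ('X - ('X_i ^+ r)%:P).
Proof.
have sX : scales r ('X_i ^+ r : S) by have := scales_exp r (@scalesX K l i); rewrite mul1n.
move=> [|[|j]]; rewrite coefB coefX coefC /=.
- by rewrite muln0 scale1r sub0r rmorphN sX scalerN.
- by rewrite muln1 subr0 rmorph1.
- by rewrite subr0 rmorph0 !scaler0.
Qed.

Lemma wscales_lambda_sX p : wscales (r * l * p) (lambda_s K l r ^+ p).
Proof.
have sl : wscales (r * l) (lambda_s K l r).
  have -> : (r * l = \sum_(i < l) r)%N by rewrite sum_nat_const card_ord mulnC.
  elim/big_ind2: (lambda_s _ _ _) => [|*|i _]; first exact: wscales1.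
    exact: wscalesM.
  exact: wscales_factor.
elim: p => [|p IHp]; first by rewrite muln0; apply: wscales1.
by rewrite exprS mulnS; apply: wscalesM.
Qed.

Lemma wscales_euler_int e d p : wscales d p -> wscales d (euler_int r e p).
Proof.
move=> sp j; rewrite coef_euler_int /= comp_mpolyZ.
by rewrite scalerA mulrC -scalerA [X in _ *: X]sp !scalerA mulrC.
Qed.

Lemma wscales_horner d p (i : 'I_l) : wscales d p -> scales d p.['X_i ^+ r].
Proof.
move=> sp; rewrite /scales horner_coef rmorph_sum scaler_sumr.
apply: eq_bigr => j _; rewrite -exprM rmorphM.
have -> : double_vars K l ('X_i ^+ (r * j)) = 2%:R ^+ (r * j) *: 'X_i ^+ (r * j).
  by have := scales_exp (r * j) (@scalesX K l i); rewrite mul1n.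
by rewrite -scalerAr scalerAl sp scalerAl.
Qed.

Lemma sum_ord_nat p : (2 * \sum_(j < p) j + p = p * p)%N.
Proof.
elim: p => [|p]; rewrite ?big_ord0 // big_ord_recr /=.
by move: (\sum_(j < p) j)%N => T; nia.
Qed.

Variables (m n : nat) (mbar : 'I_l -> nat).

Lemma eta_matrix_scales (theta : 'M[S]_l) : (0 < l)%N -> eta_matrix r m n mbar theta ->
  @scales K l (\sum_i mbar i + \sum_(j < l) (r * (n + j) + 1 + r * l * m))
    (\det theta * \prod_(i < l) 'X_i ^+ (r * m.+1)).
Proof.
move=> l_gt0 thE.
(* Scaling column i by x_i^pole gives entries with explicit numerators, each row having a single
   degree. *)
pose N : 'M[S]_l := \matrix_(j, i) ('X_i ^+ (r * m.+1) * theta j i).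
have -> : \det theta * \prod_(i < l) 'X_i ^+ (r * m.+1) = \det N.
  have -> : N = theta *m diag_mx (\row_i 'X_i ^+ (r * m.+1)).
    by rewrite mul_mx_diag; apply/matrixP => j i; rewrite !mxE mulrC.
  by rewrite det_mulmx det_diag; congr (_ * _); apply: eq_bigr => i _; rewrite mxE.
pose dm (j : 'I_l) := if val j == 0%N then (\sum_i mbar i)%N else 0%N.
have -> : (\sum_i mbar i + \sum_(j < l) (r * (n + j) + 1 + r * l * m) =
    \sum_j (dm j + (r * (n + j) + 1 + r * l * m)))%N.
  rewrite [RHS]big_split /=; congr (_ + _)%N.
  rewrite [RHS](bigD1 (Ordinal l_gt0)) //= [X in (_ + X)%N]big1 ?addn0 // => j; rewrite -val_eqE /dm /=.
  by move=> /negbTE ->.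
apply: scales_det => j i; rewrite mxE thE; apply: scalesM.
  rewrite /mono_factor /dm; case: ifP => _; last exact: scales1.
  apply: scales_prod => i' _.
  by have := scales_exp (mbar i') (@scalesX K l i'); rewrite mul1n.
apply: scalesM; last by apply/wscales_horner/wscales_euler_int/wscales_lambda_sX.
by have := scales_exp (r * (n + j) + 1) (@scalesX K l i); rewrite mul1n.
Qed.

End EtaDegree.

(** * Comparison with the fields over the fraction field *)

Section BasisFields.
Variables (K : numFieldType) (l : nat).
Local Notation tofrac := (@FracField.tofrac {mpoly K[l]}).

Lemma eta_matrix_basis_fields (r m n : nat) (mbar : 'I_l -> nat)
    (theta : 'M[{mpoly K[l]}]_l) j :
  eta_matrix r m n mbar theta ->
  map_mx tofrac (row j theta) =
    basis_fields K r m (n%:Z - m%:Z - 1) mbar j.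
Proof.
move=> thE.
apply/rowP => i; rewrite !mxE.
have X0 : tofrac 'X_i != 0 by rewrite tofrac_eq0 mpolyU_neq0.
have pole0 : tofrac 'X_i ^+ (r * m.+1) != 0 by rewrite expf_neq0.
pose u : int := n%:Z - m%:Z - 1 + (val j)%:Z.
have etaE : tofrac 'X_i ^+ (r * m.+1) * Defs.eta K l r m u 0 i =
    tofrac ('X_i ^+ (r * (n + j) + 1) *
      (euler_int r ((r * (n + j) + 1)%N%:Z - (r * m.+1)%N%:Z)
         (lambda_s K l r ^+ m)).['X_i ^+ r]).
  have lamX : lambda K l r ^+ m = (lambda_s K l r ^+ m) \Po 'X^r.
    by rewrite rmorphXn /= -lambda_comp.
  rewrite mxE lamX laurent_int_comp.
  have -> : r%:Z * u + 1 = (r * (n + j) + 1)%N%:Z - (r * m.+1)%N%:Z.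
    by rewrite /u -addn1 !(PoszD, PoszM) /=; ring.
  rewrite mulrA exprnP -expfzDr // addrC subrK -exprnP.
  by rewrite [RHS]rmorphM /= rmorphXn.
apply: (mulfI pole0); rewrite -[LHS]/(tofrac 'X_i ^+ (r * m.+1) * tofrac (theta j i)).
have -> : tofrac 'X_i ^+ (r * m.+1) * tofrac (theta j i) =
    tofrac ('X_i ^+ (r * m.+1) * theta j i) by rewrite [RHS]rmorphM /= rmorphXn.
rewrite thE rmorphM /= -etaE /basis_fields /mono_factor.
case: ifP => [j0|_]; last by rewrite rmorph1 mul1r.
by rewrite [in RHS]mxE mulrCA /u (eqP j0) addr0.
Qed.

End BasisFields.

(** * Membership, degree count and basis property *)

Section MonomialBasis.
Variables (K : numClosedFieldType) (l r m n : nat) (mbar mu : 'I_l -> nat).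
Hypotheses (r_gt1 : (1 < r)%N) (l_gt0 : (0 < l)%N).
Hypothesis muE : forall i, (mu i + r = r * n + 1 + mbar i)%N.
Local Notation S := {mpoly K[l]}.
Local Notation A := (monomial_multiarrangement K r_gt1 mu (2 * m + 1)).

Lemma eta_matrix_logder (theta : 'M[S]_l) j : eta_matrix r m n mbar theta ->
  (forall i, divides ('X_i ^+ mu i) (theta j i)) -> logder A (row j theta).
Proof.
move=> thE mu_div [i|[[[i i'] /= ii'] z]].
  rewrite /hform /= der_apply_linform linform_delta.
  have [g gE] := mu_div i; exists g; rewrite (bigD1 i) //= !mxE !eqxx scale1r gE.
  by rewrite big1 ?addr0 // => i' i'i; rewrite !mxE (negbTE i'i) scale0r.
have ni := ltn_ord_neq ii'; have z0 := ssval_unity_neq0 r_gt1 z.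
have zr : ssval z ^+ r = 1.
  by apply/eqP; rewrite -Defs.mem_unity_roots ?(ltnW r_gt1) //; apply: ssvalP.
set H : hidx A := inr _.
have HE : hform H = 'X_i - ssval z *: 'X_i'.
  by rewrite /hform /= linformBZ !linform_delta.
have -> : der_apply (row j theta) (hform H) = theta j i - ssval z *: theta j i'.
  rewrite der_apply_linform (bigD1 i) //= (bigD1 i') 1?eq_sym //= big1; last first.
    move=> q /andP[qi qi']; rewrite !mxE (negbTE qi) (negbTE qi') mulr0 subr0.
    by rewrite scale0r.
  rewrite !mxE !eqxx (negbTE ni) [i' == i]eq_sym (negbTE ni) mulr0 subr0 mulr1.
  by rewrite sub0r scale1r scaleNr addr0.
have D := eta_matrix_diff r_gt1 j thE ni zr z0; rewrite -HE in D.
(* The powers of x_i and x_i' that cleared denominators are prime to the form of H, since coordinate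
   hyperplanes differ from H. *)
apply: (kernel_cancel (elim_form_kernel (hcoef_neq0 H)) _ D).
have elimX q : elim_form (hcoef H) 'X_q != 0.
  rewrite -linform_delta; apply: elim_form_neq0 => c.
  by apply: (@hcoef_ncol _ _ A (inl q) H c).
by rewrite rmorphM !rmorphXn mulf_neq0 // expf_neq0.
Qed.

(** The degree is stated as in [eta_matrix_scales], so that Q and the determinant can be compared
    directly. *)
Lemma defining_poly_scales :
  scales (\sum_i mbar i + \sum_(j < l) (r * (n + j) + 1 + r * l * m))
    (defining_poly A * \prod_(i < l) 'X_i ^+ (r * m.+1)).
Proof.
have sX d i : scales d ('X_i ^+ d : S).
  by have := scales_exp d (@scalesX K l i); rewrite mul1n.
rewrite defining_poly_monomial.
have -> : (\sum_i mbar i + \sum_(j < l) (r * (n + j) + 1 + r * l * m) =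
    \sum_(i < l) mu i + \sum_(i < l) \sum_(j < l | (i < j)%N) r * (2 * m + 1) +
    \sum_(i < l) r * m.+1)%N.
  have -> : (\sum_(i < l) \sum_(j < l | (i < j)%N) r * (2 * m + 1) =
      (\sum_(j < l) j) * (r * (2 * m + 1)))%N.
    rewrite (exchange_big_dep xpredT) //= big_distrl; apply: eq_bigr => j _.
    rewrite sum_nat_const; congr (_ * _)%N.
    have -> : #|[pred i : 'I_l | (i < j)%N]| = #|[set widen_ord (ltnW (ltn_ord j)) i | i in 'I_j]|.
      apply: eq_card => i; rewrite inE; apply/idP/imsetP => [ij|[i' _ ->] /=]; last exact: ltn_ord.
      by exists (Ordinal ij) => //; apply: val_inj.
    rewrite card_imset ?card_ord // => i1 i2 /(congr1 val) /= e; exact: val_inj.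
  have muS : (\sum_(i < l) mu i + l * r = l * (r * n + 1) + \sum_(i < l) mbar i)%N.
    have -> : (l * r = \sum_(i < l) r)%N by rewrite sum_nat_const card_ord.
    rewrite -big_split /= (eq_bigr _ (fun i _ => muE i)) big_split /=.
    by rewrite sum_nat_const card_ord.
  have -> : (\sum_(j < l) (r * (n + j) + 1 + r * l * m) =
      l * (r * n + 1) + r * \sum_(j < l) j + l * (r * l * m))%N.
    rewrite big_split /= big_split /= !sum_nat_const card_ord.
    rewrite -big_distrr /= big_split /= sum_nat_const card_ord; lia.
  rewrite sum_nat_const card_ord.
  have := sum_ord_nat l; move: muS.
  move: (\sum_(i < l) mu i)%N (\sum_(i < l) mbar i)%N (\sum_(i < l) i)%N => M B T.
  move=> e1 e2.
  (* Adding l r to both sides lets [muS] be used without subtraction; the pair count enters through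
     2 T + l = l^2. *)
  suff : (B + (l * (r * n + 1) + r * T + l * (r * l * m)) + l * r =
     M + T * (r * (2 * m + 1)) + l * (r * m.+1) + l * r)%N by lia.
  have -> : (l * (r * l * m) = r * m * (2 * T + l))%N by rewrite e2; lia.
  rewrite [RHS](_ : _ = (M + l * r) + T * (r * (2 * m + 1)) + l * (r * m.+1))%N; last by lia.
  rewrite e1; lia.
apply: scalesM; last by apply: scales_prod => i _; apply: sX.
apply: scalesM; first by apply: scales_prod => i _; apply: sX.
apply: scales_prod => i _; apply: scales_prod => j _.
by apply: scales_exp; apply: scalesB.
Qed.

(** The determinant is g Q. Equal degrees make g constant, and a nonzero determinant makes that
    constant nonzero, so Saito's criterion applies. *)
Lemma eta_matrix_basis (theta : 'M[S]_l) : eta_matrix r m n mbar theta ->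
  (forall j i, divides ('X_i ^+ mu i) (theta j i)) ->
  is_module_basis (logder A) (fun j => row j theta).
Proof.
move=> thE mu_div.
have DM j : logder A (row j theta) by apply: eta_matrix_logder.
have [g gE] := logder_det_divides DM.
have det0 := eta_matrix_det_neq0 r_gt1 thE.
have Q0 : defining_poly A * \prod_(i < l) 'X_i ^+ (r * m.+1) != 0.
  rewrite mulf_neq0 //; first by apply: contra_neq det0 => Q0; rewrite gE Q0 mulr0.
  by rewrite prodf_seq_neq0; apply/allP => i _; rewrite /= expf_neq0 // mpolyU_neq0.
have sdet := eta_matrix_scales l_gt0 thE.
rewrite gE -mulrA in sdet.
have [c cE] := scales_quotient Q0 defining_poly_scales sdet.
apply: (@saito_criterion _ _ A theta c) => //.
  by apply: contra_neq det0 => c0; rewrite gE cE c0 mpolyC0 mul0r.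
by rewrite gE cE mul_mpolyC.
Qed.

End MonomialBasis.

Theorem theorem3p4 (R : realType) (l r m : nat) (k : int) (mbar : 'I_l -> nat)
    (hl : (2 <= l)%N) (hr : (2 <= r)%N)
    (hk : - m%:Z - 1 <= k)
    (hmbar : forall i, (mbar i <= r - 1)%N)
    (hmi : forall i, 0 <= r%:Z * (m%:Z + k) + 1 + (mbar i)%:Z) :
  exists theta : 'I_l -> 'rV[{mpoly (complex R)[l]}]_l,
    (forall j,
       map_mx (@FracField.tofrac {mpoly (complex R)[l]}) (theta j)
         = basis_fields (complex R) r m k mbar j)
    /\ is_module_basis
         (logder (monomial_multiarrangement (complex R) hr
            (fun i => absz (r%:Z * (m%:Z + k) + 1 + (mbar i)%:Z)%R) (2 * m + 1)))
         theta.
Proof.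
(* The bound k >= -m-1 makes this argument nonnegative, so [absz] does not alter it. *)
pose n := absz (k + m%:Z + 1).
have kE : k = n%:Z - m%:Z - 1 by rewrite /n; lia.
pose mu (i : 'I_l) := absz (r%:Z * (m%:Z + k) + 1 + (mbar i)%:Z)%R.
have muE i : (mu i + r = r * n + 1 + mbar i)%N.
  have muZ : (mu i)%:Z = r%:Z * (m%:Z + k) + 1 + (mbar i)%:Z by rewrite /mu gez0_abs // hmi.
  by apply/eqP; rewrite -eqz_nat !PoszD PoszM muZ kE; apply/eqP; ring.
have [theta thE mu_div] := eta_matrix_exists (complex R) m hr muE hmbar.
exists (fun j => row j theta); split.
  by move=> j; rewrite kE; apply: eta_matrix_basis_fields.
exact: (eta_matrix_basis hr (ltnW hl) muE thE mu_div).
Qed.
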